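(* Consider an AC optimal power flow problem (AC-OPF) on a power network $(\mathcal{N},\mathcal{L})$ with $n=|\mathcal{N}|$ buses, and consider a convex relaxation of it based on the lifted linear power flow constraint $p_{ij}+\jmath q_{ij}=(\mathbf{W}_{ii}-\mathbf{W}_{ij})\,y_{ij}^*$ for all $ij\in\mathcal{L}$, where $\mathbf{W}\in\mathbb{C}^{n\times n}$ is a Hermitian matrix variable. Let $\mathcal{W}\subset\mathbb{C}^{n\times n}$ be the set of optima (the optimal values of the matrix variable $\mathbf{W}$) of this relaxation. Then the relaxation is exact if and only if there exists $\mathbf{W}^\star\in\mathcal{W}$ such that $\operatorname{rank}\mathbf{W}^\star=1$.
   Context: Network. $\mathcal{N}=\{1,\dots,n\}$ is the set of buses and $\mathcal{L}\subset\mathcal{N}\times\mathcal{N}$ the set of power lines; each line is represented in both orientations (if $ij\in\mathcal{L}$ then $ji\in\mathcal{L}$), with admittance $y_{ij}\in\mathbb{C}$. $\mathcal{G}\subset\mathcal{N}$ is the set of generator buses, and $f_i:\mathbb{R}\to\mathbb{R}$ is a convex cost function for $i\in\mathcal{G}$. The symbol $\jmath$ is the imaginary unit, $^*$ on a complex scalar is complex conjugation, and $^{\mathrm H}$ is conjugate transpose. The data also include real bounds $0<\underline{v}\le\overline{v}$, $\underline{p}_i\le\overline{p}_i$, $\underline{q}_i\le\overline{q}_i$ ($i\in\mathcal{N}$) and $\overline{s}_{ij}$ ($ij\in\mathcal{L}$). AC-OPF. The variables are $v_i\in\mathbb{C}$, $p_i,q_i\in\mathbb{R}$ ($i\in\mathcal{N}$)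 and $p_{ij},q_{ij}\in\mathbb{R}$ ($ij\in\mathcal{L}$). Minimize $\sum_{i\in\mathcal{G}}f_i(p_i)$ subject to (a) $p_{ij}+\jmath q_{ij}=v_i(v_i^*-v_j^* )y_{ij}^*$ for $ij\in\mathcal{L}$; (b) $\underline{v}\le|v_i|\le\overline{v}$ for $i\in\mathcal{N}$; (c) $p_i=\sum_{j:\,ij\in\mathcal{L}}p_{ij}$ and $q_i=\sum_{j:\,ij\in\mathcal{L}}q_{ij}$ for $i\in\mathcal{N}$; (d) $\underline{p}_i\le p_i\le\overline{p}_i$ and $\underline{q}_i\le q_i\le\overline{q}_i$ for $i\in\mathcal{N}$; (e) $p_{ij}^2+q_{ij}^2\le\overline{s}_{ij}^2$ for $ij\in\mathcal{L}$. Lifted equivalent problem (AC-OPF-Eq). Replace the variables $v_i$ by a Hermitian matrix $\mathbf{W}\in\mathbb{C}^{n\times n}$, replace (a) by (a') $p_{ij}+\jmath q_{ij}=(\mathbf{W}_{ii}-\mathbf{W}_{ij})y_{ij}^*$ for $ij\in\mathcal{L}$, replace (b) by (b') $\underline{v}^2\le\mathbf{W}_{ii}\le\overline{v}^2$ for $i\in\mathcal{N}$, keep (c), (d), (e) and the objective, and add the constraints $\mathbf{W}\succeq0$ and $\operatorname{rank}\mathbf{W}=1$. This problem is equivalent to AC-OPF through $\mathbf{W}=\mathbf{v}\mathbf{v}^{\mathrm H}$, where $\mathbf{v}=(v_i)_{i\in\mathcal{N}}$. Convex relaxation based on the lifted constraint. This is a convex optimization problem with the same objective, with variables $\mathbf{W}$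 (Hermitian), $p_i,q_i,p_{ij},q_{ij}$ and possibly auxiliary variables, and whose constraints are (a'), (b'), (c), (d), (e) and possibly additional convex constraints, such that every feasible point of AC-OPF-Eq is feasible for it (for a suitable choice of any auxiliary variables). The case with no additional constraints is allowed. Exactness. The relaxation is exact if it has an optimal solution that is feasible for AC-OPF-Eq; equivalently, it has an optimal solution which (via $\mathbf{W}=\mathbf{v}\mathbf{v}^{\mathrm H}$) yields a global optimum of the original AC-OPF. *)

(* Defs.v *)
From HB Require Import structures.
From mathcomp Require Import all_boot all_order all_algebra.
From mathcomp Require Import sesquilinear spectral.
From mathcomp Require Import boolp classical_sets reals convex.
From mathcomp Require Export complex.

Set Implicit Arguments.
Unset Strict Implicit.
Unset Printing Implicit Defensive.

Set Warnings "-redundant-canonical-projection".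

Import Order.TTheory GRing.Theory Num.Theory.
Local Open Scope ring_scope.
Local Open Scope complex_scope.
Local Open Scope sesquilinear_scope.

(* Complex matrices as a vector space over R: the library only scales them by
   complex numbers, whereas convexity needs real scalars. *)
Definition cmatrix (R : rcfType) (n : nat) : Type := 'M[R[i]]_n.

Section RealScaling.
Variables (R : rcfType) (n : nat).

HB.instance Definition _ := GRing.Zmodule.copy (cmatrix R n) 'M[R[i]]_n.

Definition cmatrix_scale (a : R) (W : cmatrix R n) : cmatrix R n :=
  (a%:C : R[i]) *: (W : 'M[R[i]]_n).

Fact cmatrix_scaleA a b W :
  cmatrix_scale a (cmatrix_scale b W) = cmatrix_scale (a * b) W.
Proof. by rewrite /cmatrix_scale scalerA -rmorphM. Qed.

Fact cmatrix_scale1 : left_id 1 cmatrix_scale.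
Proof. by move=> W; rewrite /cmatrix_scale rmorph1 scale1r. Qed.

Fact cmatrix_scaleDr : right_distributive cmatrix_scale +%R.
Proof. by move=> a V W; rewrite /cmatrix_scale; exact: scalerDr. Qed.

Fact cmatrix_scaleDl W : {morph cmatrix_scale^~ W : a b / a + b}.
Proof. by move=> a b; rewrite /cmatrix_scale rmorphD; exact: scalerDl. Qed.

HB.instance Definition _ := GRing.Zmodule_isLmodule.Build R (cmatrix R n)
  cmatrix_scaleA cmatrix_scale1 cmatrix_scaleDr cmatrix_scaleDl.

End RealScaling.

Definition psdmx (R : rcfType) (n : nat) (W : 'M[R[i]]_n) : Prop :=
  W \is hermsymmx /\ forall x : 'cV[R[i]]_n, 0 <= (x^t* *m W *m x) 0 0.

(* The values of [admittance] and [smax] off [lines], and of [cost] off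
   [generators], are irrelevant: nothing below refers to them. *)
Record network (R : realType) (n : nat) := Network {
  lines : {set 'I_n * 'I_n};
  lines_sym : forall i j, (i, j) \in lines -> (j, i) \in lines;
  admittance : 'I_n -> 'I_n -> R[i];
  generators : {set 'I_n};
  cost : 'I_n -> R -> R;
  cost_convex : forall i, i \in generators ->
    convex_function [set: convex_lmodType R^o] (cost i);
  vmin : R;
  vmax : R;
  vmin_gt0 : 0 < vmin;
  vmin_le_vmax : vmin <= vmax;
  pmin : 'I_n -> R;
  pmax : 'I_n -> R;
  pmin_le_pmax : forall i, pmin i <= pmax i;
  qmin : 'I_n -> R;
  qmax : 'I_n -> R;
  qmin_le_qmax : forall i, qmin i <= qmax i;
  smax : 'I_n -> 'I_n -> R
}.

Section OPF.
Variables (R : realType) (n : nat) (N : network R n).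

Definition line : finType := {l : 'I_n * 'I_n | l \in lines N}.
Definition src (l : line) : 'I_n := (val l).1.
Definition dst (l : line) : 'I_n := (val l).2.

(* A point is ((((W, p), q), pl), ql); a product is used, rather than a record,
   so that points inherit the structure of a real vector space. *)
Definition opf_point : Type :=
  (cmatrix R n * 'rV[R]_n * 'rV[R]_n * {ffun line -> R^o} * {ffun line -> R^o})%type.

Definition opf_W (x : opf_point) : 'M[R[i]]_n := x.1.1.1.1.
Definition opf_p (x : opf_point) (i : 'I_n) : R := x.1.1.1.2 0 i.
Definition opf_q (x : opf_point) (i : 'I_n) : R := x.1.1.2 0 i.
Definition opf_pl (x : opf_point) (l : line) : R := x.1.2 l.
Definition opf_ql (x : opf_point) (l : line) : R := x.2 l.

Definition opf_cost (x : opf_point) : R :=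
  \sum_(i in generators N) cost N i (opf_p x i).

Definition lifted_power_flow (x : opf_point) : Prop :=
  forall l : line,
    opf_pl x l +i* opf_ql x l =
    (opf_W x (src l) (src l) - opf_W x (src l) (dst l))
      * ((admittance N (src l) (dst l))^*)%R.

(* The order of R[i] only compares numbers with the same imaginary part, so
   these bounds say in particular that the diagonal of W is real. *)
Definition voltage_bounds (x : opf_point) : Prop :=
  forall i, (vmin N ^+ 2)%:C <= opf_W x i i <= (vmax N ^+ 2)%:C.

Definition power_balance (x : opf_point) : Prop :=
  forall i, opf_p x i = \sum_(l : line | src l == i) opf_pl x l /\
            opf_q x i = \sum_(l : line | src l == i) opf_ql x l.

Definition injection_bounds (x : opf_point) : Prop :=
  forall i, pmin N i <= opf_p x i <= pmax N i /\
            qmin N i <= opf_q x i <= qmax N i.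

Definition line_limits (x : opf_point) : Prop :=
  forall l, opf_pl x l ^+ 2 + opf_ql x l ^+ 2 <= smax N (src l) (dst l) ^+ 2.

Definition lifted_constraints (x : opf_point) : Prop :=
  [/\ opf_W x \is hermsymmx, lifted_power_flow x & voltage_bounds x] /\
  [/\ power_balance x, injection_bounds x & line_limits x].

Definition acopf_eq_feasible (x : opf_point) : Prop :=
  [/\ lifted_constraints x, psdmx (opf_W x) & \rank (opf_W x) = 1%N].

(* Any family of additional convex constraints is represented by the
   intersection of the convex sets that they define, in the space of the
   variables extended with [naux] real auxiliary variables (a complex one
   counts as two real ones); no additional constraint is [naux = 0] and
   [extra = setT]. *)
Record relaxation := Relaxation {
  naux : nat;
  extra : set (convex_lmodType (opf_point * 'rV[R]_naux)%type);
  extra_convex : convex_set extra;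
  extra_relaxes : forall x, acopf_eq_feasible x ->
    exists a : 'rV[R]_naux, lifted_constraints x /\ extra (x, a)
}.

Section Relaxation.
Variable P : relaxation.

Definition relax_feasible (z : opf_point * 'rV[R]_(naux P)) : Prop :=
  lifted_constraints z.1 /\ @extra P z.

Definition relax_optimal (z : opf_point * 'rV[R]_(naux P)) : Prop :=
  relax_feasible z /\
  forall z', relax_feasible z' -> opf_cost z.1 <= opf_cost z'.1.

Definition relax_optima : set 'M[R[i]]_n :=
  [set W | exists2 z, relax_optimal z & W = opf_W z.1]%classic.

Definition exact : Prop :=
  exists2 z, relax_optimal z & acopf_eq_feasible z.1.

End Relaxation.
End OPF.

(* Main.v *)
(** A rank-one matrix W with W i i <> 0 is the outer product of its i-th column
    and i-th row, divided by W i i.  If W is moreover Hermitian with W i i > 0,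
    the row is the conjugate transpose of the column, so W is positive
    semidefinite.  The lower voltage bound gives W i i >= vmin^2 > 0, so a
    rank-one optimum of the relaxation satisfies W >= 0 automatically. *)
Require Import Defs.
From mathcomp Require Import all_boot all_order all_algebra.
From mathcomp Require Import classical_sets reals.
From mathcomp Require Import sesquilinear spectral.

Section RankOne.

Import Order.TTheory GRing.Theory Num.Theory.
Local Open Scope ring_scope.
Local Open Scope sesquilinear_scope.

(** Row [i] is nonzero, so it spans the one-dimensional row space; the coefficient of each row is
    read off column [j]. *)
Lemma rank1_outer_product (F : fieldType) (m n : nat) (A : 'M[F]_(m, n))
    (i : 'I_m) (j : 'I_n) :
  \rank A = 1%N -> A i j != 0 -> A = (A i j)^-1 *: (col j A *m row i A).
Proof.
move=> rkA Aij0.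
have /submxP[D AE] : (A <= row i A)%MS.
  (* Otherwise [row i A] would have rank below 1 and vanish, against [A i j != 0]. *)
  have /mxrank_leqif_sup/leqifP := row_sub i A; case: ifP => // _.
  rewrite rkA ltnS leqn0 mxrank_eq0 => /eqP/rowP/(_ j).
  by rewrite !mxE => /eqP; rewrite (negPf Aij0).
have AD k l : A k l = D k 0 * A i l.
  by rewrite [in LHS]AE mxE big_ord1 !mxE.
apply/matrixP=> k l; rewrite !mxE big_ord1 !mxE [A k l]AD [A k j]AD.
by rewrite (mulrC (D k 0) (A i j)) -mulrA mulKf.
Qed.

Lemma rank1_hermsymmx_psdmx (R : rcfType) (n : nat) (W : 'M[R[i]]_n)
    (i : 'I_n) :
  W \is hermsymmx -> \rank W = 1%N -> 0 < W i i -> psdmx W.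
Proof.
move=> hW rkW Wii_gt0; split=> // x.
have rowW : row i W = (col i W)^t*.
  have /is_hermitianmxP WE := hW.
  by apply/rowP=> k; rewrite [in LHS]WE expr0 scale1r !mxE.
rewrite (rank1_outer_product _ _ _ W i i rkW (lt0r_neq0 Wii_gt0)) rowW.
rewrite -scalemxAr -scalemxAl mxE mulr_ge0 ?invr_ge0 ?(ltW Wii_gt0) //.
(* The quadratic form reduces to the squared modulus of the 1 x 1 matrix [y]. *)
set y := x^t* *m col i W.
have -> : x^t* *m (col i W *m (col i W)^t*) *m x = y *m y^t*.
  by rewrite !mulmxA -mulmxA /y trmx_mul map_mxM /= trmxCK.
by rewrite mxE big_ord1 !mxE mul_conjC_ge0.
Qed.

Lemma lifted_rank1_acopf_eq_feasible (R : realType) (n : nat)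
    (N : network R n) (x : opf_point N) :
  lifted_constraints x -> \rank (opf_W x) = 1%N -> acopf_eq_feasible x.
Proof.
move=> xlift rkW; split=> //; have [[hW _ bounds] _] := xlift.
(* Rank one forces [n] to be positive, so index 0 can provide the positive diagonal entry. *)
have n_gt0 : (0 < n)%N by rewrite (leq_trans _ (rank_leq_row (opf_W x))) ?rkW.
apply: (@rank1_hermsymmx_psdmx _ _ _ (Ordinal n_gt0)) => //.
have /andP[+ _] := bounds (Ordinal n_gt0).
by apply: lt_le_trans; rewrite ltcR exprn_gt0 ?vmin_gt0.
Qed.

End RankOne.

Theorem theorem1 (R : realType) (n : nat) (N : network R n)
    (P : relaxation N) :
  exact P <->
  exists W : 'M[R[i]]_n, relax_optima P W /\ \rank W = 1.
Proof.
split=> [[z zopt [_ _ rkW]] | [W [[z zopt ->] rkW]]].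
  by exists (opf_W z.1); split=> //; exists z.
exists z => //; have [[zlift _] _] := zopt.
exact: lifted_rank1_acopf_eq_feasible.
Qed.
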